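(* Let $n\ge 1$, let $\varphi$ be a decreasing nonnegative weight function on the adjacent transpositions of $\mathbb{S}_n$, and let $\mathsf{d}_\varphi$ be the weighted Kendall distance with weight function $\varphi$. For all rankings $\pi,\sigma\in\mathbb{S}_n$, $$\mathsf{d}_\varphi(\pi,\sigma)=\sum_{i=1}^{n}\frac12\left(\sum_{j=\pi^{-1}(i)}^{\ell_i-1}\varphi_{(j\ j+1)}+\sum_{j=\sigma^{-1}(i)}^{\ell_i-1}\varphi_{(j\ j+1)}\right),$$ where $\ell_i=\left(\pi^{-1}(i)+\sigma^{-1}(i)+I_i(\pi,\sigma)\right)/2$.
   Context: $\mathbb{S}_n$ is the symmetric group on $[n]=\{1,\dots,n\}$. A permutation $\pi$ is viewed as the ranking $\pi(1)\pi(2)\cdots\pi(n)$, so $\pi^{-1}(a)$ is the position of element $a$. Products are compositions, $(\pi\sigma)(i)=\pi(\sigma(i))$, so $\pi(a\ b)$ is obtained from $\pi$ by swapping the elements in positions $a$ and $b$. An adjacent transposition is one of the form $(a\ a+1)$, $a\in[n-1]$. $A(\pi,\sigma)$ is the set of all finite sequences $(\tau_1,\dots,\tau_m)$, $m\ge 0$, of adjacent transpositions with $\sigma=\pi\tau_1\cdots\tau_m$ (the empty sequence is allowed when $\pi=\sigma$). For a nonnegative weight function $\varphi$, $\tau\mapsto\varphi_\tau$, on the adjacent transpositions, the weighted Kendall distance is $$\mathsf{d}_\varphi(\pi,\sigma)=\min_{(\tau_1,\dots,\tau_m)\in A(\pi,\sigma)}\sum_{i=1}^m\varphi_{\tau_i}.$$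 $\varphi$ is decreasing if $i>j$ implies $\varphi_{(i\ i+1)}\le\varphi_{(j\ j+1)}$. Rankings $\pi,\sigma$ disagree on a pair $\{i,j\}$ of distinct elements if one places $i$ before $j$ and the other places $j$ before $i$. $I_i(\pi,\sigma)$ is the number of elements $j\in[n]$ such that $\pi$ and $\sigma$ disagree on $\{i,j\}$. An empty sum is $0$. *)

(* Defs.v *)
From HB Require Import structures.
From mathcomp Require Import all_boot all_order all_fingroup all_algebra.
From mathcomp Require Import boolp classical_sets reals zify.

Set Implicit Arguments.
Unset Strict Implicit.
Unset Printing Implicit Defensive.

Import Order.TTheory GRing.Theory Num.Theory.
Local Open Scope ring_scope.

(* [n+1] = {1, ..., n+1} is encoded as 'I_n.+1 = {0, ..., n}, so that the
   integers n >= 1 are the n.+1.  Both elements and positions are shifted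
   down by one.  A permutation p is the ranking p 0, p 1, ..., p n, so that
   p maps positions to elements. *)

Section Defs.
Variable n : nat.
Implicit Types (p q s t : 'S_n.+1) (a b : 'I_n.+1).

(* p after q: the group product of permutations applies its left factor
   first, see pcompE. *)
Definition pcomp p q : 'S_n.+1 := (q * p)%g.

Lemma pcompE p q a : pcomp p q a = p (q a).
Proof. by rewrite permM. Qed.

Definition pos p a : nat := (p^-1)%g a.

(* The adjacent transposition of positions j and j+1, numbered from 0.
   Only meaningful for j < n: inord is the identity on values <= n. *)
Definition adjt (j : nat) : 'S_n.+1 := tperm (inord j) (inord j.+1).

Definition adjacent t : bool := [exists j : 'I_n, t == adjt j].

Definition before p a b : bool := (pos p a < pos p b)%N.

Definition disagree p q a b : bool :=
  (before p a b && before q b a) || (before p b a && before q a b).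

Definition ndisagree p q a : nat := #|[set b | disagree p q a b]|.

(* With positions numbered from 0, this is the value of
   (pos p a + pos q a + I_a(p, q)) / 2 for positions numbered from 1, minus 1,
   i.e. shifted like the positions.  The halving is exact: see ell_double. *)
Definition ell p q a : nat := (pos p a + pos q a + ndisagree p q a)./2.

Local Open Scope classical_set_scope.

Definition words p q : set (seq 'S_n.+1) :=
  [set w | all adjacent w /\ q = foldl pcomp p w].

Variable R : realType.
Implicit Type phi : 'S_n.+1 -> R.

(* A weight function is only constrained, and only used, on adjacent
   transpositions. *)
Definition nonneg_weight phi : Prop := forall t, adjacent t -> 0 <= phi t.

Definition decreasing_weight phi : Prop :=
  forall i j : nat, (i < n)%N -> (j < n)%N -> (j < i)%N ->
    phi (adjt i) <= phi (adjt j).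

Definition weight phi (w : seq 'S_n.+1) : R := \sum_(t <- w) phi t.

Definition is_min (S : set R) (m : R) : Prop := S m /\ lbound S m.

(* The default value 0 is never used for nonnegative weights: see
   wkendallP. *)
Definition wkendall phi p q : R :=
  xget 0 (is_min (weight phi @` words p q)).

End Defs.

Section Facts.
Variable n : nat.
Implicit Types (p q s t : 'S_n.+1) (a b : 'I_n.+1).

Lemma card_before p a : #|[set b | before p b a]| = pos p a.
Proof.
have -> : [set b | before p b a] = p @: [set c : 'I_n.+1 | (c < pos p a)%N].
  apply/setP=> b; rewrite !inE; apply/idP/imsetP => [ba|[c]].
    by exists ((p^-1)%g b); rewrite ?inE ?permKV.
  by rewrite inE => cp ->; rewrite /before {1}/pos permK.
rewrite card_imset; last exact: perm_inj.
have le_n : (pos p a <= n.+1)%N by rewrite ltnW // ltn_ord.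
have inj_w : injective (widen_ord le_n) by move=> c d [] /val_inj.
rewrite -[RHS]card_ord -(card_imset _ inj_w).
apply: eq_card => c; rewrite inE; apply/idP/imsetP => [cp|[d _ ->]].
  by exists (Ordinal cp) => //; apply: val_inj.
exact: (ltn_ord d).
Qed.

Lemma disagreeE p q a :
  [set b | disagree p q a b] =
  ([set b | before p b a] :\: [set b | before q b a]) :|:
  ([set b | before q b a] :\: [set b | before p b a]).
Proof.
have neqE r b : b != a -> before r a b = ~~ before r b a.
  move=> ba; rewrite /before -leqNgt [RHS]leq_eqVlt.
  suff /negPf -> : pos r a != pos r b by [].
  by apply: contra ba => /eqP/val_inj/perm_inj ->.
apply/setP=> b; rewrite !inE /disagree.
have [->|ba] := eqVneq b a; first by rewrite /before !ltnn.
by rewrite !neqE //; do 2!case: before.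
Qed.

Lemma ell_union p q a :
  (pos p a + pos q a + ndisagree p q a =
   #|[set b | before p b a] :|: [set b | before q b a]|.*2)%N.
Proof.
rewrite /ndisagree disagreeE -!card_before.
set A := [set b | before p b a]; set B := [set b | before q b a].
have dAB : (A :\: B) :&: (B :\: A) = finset.set0.
  by apply/setP => x; rewrite !inE; do 2!case: before.
have := cardsUI (A :\: B) (B :\: A); rewrite dAB cards0.
have := cardsUI A B; have := cardsID B A; have := cardsID A B.
by rewrite (finset.setIC B A); lia.
Qed.

Lemma ell_double p q a :
  ((ell p q a).*2 = pos p a + pos q a + ndisagree p q a)%N.
Proof. by rewrite /ell ell_union doubleK. Qed.

(* In particular the transpositions adjt j, j < ell p q a, are genuine. *)
Lemma ell_le p q a : (ell p q a <= n)%N.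
Proof.
rewrite /ell ell_union doubleK -ltnS -[X in (_ < X)%N]card_ord -cardsT.
apply: proper_card; rewrite properT; apply/eqP => /setP/(_ a).
by rewrite !inE /before !ltnn.
Qed.

Lemma pos_le_ell p q a : (pos p a <= ell p q a)%N.
Proof.
by rewrite /ell ell_union doubleK -card_before subset_leq_card // finset.subsetUl.
Qed.

Lemma foldl_pcomp p q (w : seq 'S_n.+1) :
  foldl (@pcomp n) (q * p)%g w = (foldl (@pcomp n) q w * p)%g.
Proof. by elim: w q => //= t w IH q; rewrite -IH /pcomp mulgA. Qed.

Lemma words_nonempty p q : exists w, words p q w.
Proof.
pose reach s := exists w, all (@adjacent n) w /\ s = foldl (@pcomp n) 1%g w.
have reach1 : reach 1%g by exists [::].
have reachM s t : reach s -> reach t -> reach (s * t)%g.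
  move=> [w [aw ->]] [v [av ->]]; exists (v ++ w); split.
    by rewrite all_cat av.
  by rewrite foldl_cat -foldl_pcomp mul1g.
have reachA (j : 'I_n) : reach (adjt n j).
  exists [:: adjt n j]; split; last by rewrite /= /pcomp mulg1.
  by rewrite /= andbT; apply/existsP; exists j.
have reachT (k i : nat) : (i + k < n.+1)%N ->
    reach (tperm (inord i) (inord (i + k))).
  elim: k => [|k IH] hk; first by rewrite addn0 tperm1.
  have hk' : (i + k < n)%N by rewrite addnS in hk.
  case: k => [|k] in IH hk hk' *.
    by rewrite addn1; rewrite addn0 in hk'; exact: (reachA (Ordinal hk')).
  have neq (c d : nat) : (c < n.+1)%N -> (d < n.+1)%N -> c != d ->
      inord c != inord d :> 'I_n.+1.
    by move=> hc hd; apply: contra => /eqP/(congr1 val); rewrite /= !inordK // => ->.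
  rewrite addnS tpermC -(tpermJ_tperm (x := inord (i + k.+1))); last 2 first.
  - by apply: neq; lia.
  - by apply: neq; lia.
  have rA := reachA (Ordinal hk').
  rewrite conjgE tpermV; apply: (reachM _ _ rA); apply: reachM rA.
  by rewrite tpermC; apply: IH; lia.
have reachP (a b : 'I_n.+1) : reach (tperm a b).
  wlog ab : a b / (a <= b)%N.
    by move=> h; case/orP: (leq_total a b) => /h //; rewrite tpermC.
  have := reachT (b - a)%N a; rewrite subnKC // !inord_val; apply.
  exact: ltn_ord.
have [w [aw ew]] : reach (q * p^-1)%g.
  have [ts -> _] := prod_tpermP (q * p^-1)%g.
  by elim: ts => [|t ts IH]; rewrite ?big_nil ?big_cons //; apply: reachM.
exists w; split=> //.
by rewrite -[p in RHS]mul1g foldl_pcomp -ew mulgKV.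
Qed.

Variable R : realType.
Variable phi : 'S_n.+1 -> R.
Hypothesis phi_ge0 : nonneg_weight phi.

Lemma weight_ge0 (w : seq 'S_n.+1) : all (@adjacent n) w -> 0 <= weight phi w.
Proof.
by move=> /allP aw; rewrite /weight big_seq sumr_ge0 // => t /aw /phi_ge0.
Qed.

Lemma words_shorten p q w : words p q w ->
  exists v, [/\ words p q v, (size v <= #|{: 'S_n.+1}|)%N &
                weight phi v <= weight phi w].
Proof.
move=> [aw eq_q].
suff [v [av ev uv lv]] : exists v, [/\ all (@adjacent n) v,
    foldl (@pcomp n) p v = foldl (@pcomp n) p w,
    uniq (p :: scanl (@pcomp n) p v) & weight phi v <= weight phi w].
  exists v; split=> //; first by split=> //; rewrite eq_q ev.
  have := max_card [in p :: scanl (@pcomp n) p v].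
  by move/card_uniqP: uv => ->; rewrite /= size_scanl => /ltnW.
elim: w p aw {q eq_q} => [|t w IH] p /=; first by exists [::].
case/andP=> at_ aw; have [v [av ev uv lv]] := IH (pcomp p t) aw.
have lew : weight phi w <= weight phi (t :: w).
  by rewrite /weight big_cons lerDr phi_ge0.
have [pin|pnin] := boolP (p \in pcomp p t :: scanl (@pcomp n) (pcomp p t) v);
    last first.
  exists (t :: v); split=> //=; rewrite ?at_ ?pnin //.
  by rewrite /weight !big_cons lerD2l.
have {pin} [k ek] : exists k, p = foldl (@pcomp n) (pcomp p t) (take k v).
  move/(nthP p): pin => [k hk ek]; exists k.
  rewrite -(nth_cons_scanl p) ?ek //.
  by rewrite /= size_scanl ltnS in hk.
have vE := cat_take_drop k v.
have fE : foldl (@pcomp n) p (drop k v) = foldl (@pcomp n) (pcomp p t) v.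
  by rewrite -[in RHS]vE foldl_cat -ek.
exists (drop k v); split.
- by move: av; rewrite -{1}vE all_cat => /andP[].
- by rewrite fE.
- move: uv; rewrite -{1}vE scanl_cat -cat_cons cat_uniq -ek.
  case/and3P=> _ /hasPn hd ud; rewrite /= ud andbT.
  have mem_foldl r (u : seq 'S_n.+1) :
      foldl (@pcomp n) r u \in r :: scanl (@pcomp n) r u.
    elim: u r => [|x u IHu] r; first exact: mem_head.
    by rewrite in_cons IHu orbT.
  apply/negP => /hd/negP; apply.
  by rewrite [X in X \in _]ek; apply: mem_foldl.
- apply: le_trans lew; apply: le_trans lv.
  rewrite -[in leRHS]vE /weight big_cat /= lerDr weight_ge0 //.
  by move: av; rewrite -{1}vE all_cat => /andP[].
Qed.

Lemma wkendallP p q : is_min (weight phi @` words p q)%classic (wkendall phi p q).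
Proof.
apply: xgetPex.
have [w0 /words_shorten[v0 [[av0 ev0] sv0 _]]] := words_nonempty p q.
pose N := #|{: 'S_n.+1}|.
pose P (v : N.-bseq 'S_n.+1) := all (@adjacent n) v && (q == foldl (@pcomp n) p v).
have P0 : P (Bseq sv0) by rewrite /P /= av0; apply/eqP.
case: (@arg_minP _ R _ (Bseq sv0) P (fun v => weight phi v) P0) => v.
case/andP=> av /eqP ev min_v; exists (weight phi v); split.
  by exists (v : seq _).
move=> _ [w /words_shorten[u [[au eu] su lu]] <-]; apply: le_trans lu.
by apply: (min_v (Bseq su)); rewrite /P /= au; apply/eqP.
Qed.

End Facts.

(* Main.v *)
Require Import Defs.
From mathcomp Require Import all_boot all_order all_fingroup all_algebra.
From mathcomp Require Import boolp classical_sets reals.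
From mathcomp Require Import zify lra.

(** Let [F k] be the sum of the first [k] weights.  As positions are permuted
    by a ranking, the right-hand side is [\sum_i F (ell_i) - \sum_k F k].
    Swapping the neighbours [x], [y] at positions [j], [j+1] of [p] only changes
    [ell_x], which grows by one if [q] has [x] before [y], or [ell_y], which
    drops by one otherwise.  In the latter case [ell_y >= j+1], so, the weights
    being decreasing, the sum drops by at most the weight of the swap: this is
    the lower bound.  Equality holds when [ell_y = j+1], i.e. when all elements
    before [y] in [q] are before [y] in [p]; this happens at every step of the
    insertion sort that moves [q 0], then [q 1], etc. to their places. *)

Set Implicit Arguments.
Unset Strict Implicit.
Unset Printing Implicit Defensive.

Import Order.TTheory GRing.Theory Num.Theory.
Local Open Scope ring_scope.

(** * Effect of an adjacent swap on [pos], [before] and [ell] *)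

Section AdjacentSwap.
Context {n : nat}.
Implicit Types (p q : 'S_n.+1) (a b : 'I_n.+1) (j : nat).

Lemma pos_inj p a b : pos p a = pos p b -> a = b.
Proof. by move=> /val_inj/perm_inj. Qed.

Lemma pos_inord p j : (j < n.+1)%N -> pos p (p (inord j)) = j.
Proof. by move=> jn; rewrite /pos permK inordK. Qed.

Lemma perm_inord_pos p a : p (inord (pos p a)) = a.
Proof. by rewrite /pos inord_val permKV. Qed.

(** If A and B are the sets of predecessors of [a] in [p] and in [q], then |A| + |B| + |A Δ B| = 2|A
    ∪ B|. In this form the effect of a swap on [ell] can be read off. *)
Lemma ell_card p q a : ell p q a = #|[set b | before p b a || before q b a]|.
Proof.
rewrite /ell ell_union doubleK; apply: eq_card => b.
by rewrite !inE.
Qed.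

Lemma ellC p q a : ell p q a = ell q p a.
Proof. by rewrite !ell_card; apply: eq_card => b; rewrite !inE orbC. Qed.

Lemma ellxx p a : ell p p a = pos p a.
Proof.
by rewrite ell_card -card_before; apply: eq_card => b; rewrite !inE orbb.
Qed.

Lemma pos_adjt p j a : (j < n)%N ->
  pos (Defs.pcomp p (adjt n j)) a =
  if pos p a == j then j.+1 else if pos p a == j.+1 then j else pos p a.
Proof.
move=> jn; rewrite /pos /Defs.pcomp invMg permM tpermV.
set c := (p^-1)%g a.
have cE k : (k < n.+1)%N -> (val c == k) = (c == inord k).
  by move=> kn; rewrite -val_eqE /= inordK.
have jn1 : (j < n.+1)%N by exact: ltnW.
rewrite (cE j jn1) (cE j.+1 jn) /adjt.
case: tpermP => [->|->|/eqP/negPf -> /eqP/negPf -> //].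
  by rewrite eqxx inordK.
by rewrite eqxx ifF ?inordK // -val_eqE /= !inordK //; lia.
Qed.

Lemma before_adjt p j a b : (j < n)%N ->
  before (Defs.pcomp p (adjt n j)) a b =
  if (pos p a == j) && (pos p b == j.+1) then false
  else if (pos p a == j.+1) && (pos p b == j) then true
  else before p a b.
Proof.
move=> jn; rewrite /before !pos_adjt //.
by case: (eqVneq (pos p a) j); case: (eqVneq (pos p a) j.+1);
  case: (eqVneq (pos p b) j); case: (eqVneq (pos p b) j.+1) => /=; lia.
Qed.

Lemma ell_adjt_other p q j a : (j < n)%N ->
  pos p a != j -> pos p a != j.+1 -> ell (Defs.pcomp p (adjt n j)) q a = ell p q a.
Proof.
move=> jn a0 a1; rewrite !ell_card; apply: eq_card => b; rewrite !inE.
by rewrite before_adjt // (negPf a0) (negPf a1) !andbF.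
Qed.

(** The swap adds [y], and nothing else, to the predecessors of [x] in [p]; the union gains an
    element exactly when [y] does not already precede [x] in [q]. *)
Lemma ell_adjt_left p q j (x := p (inord j)) (y := p (inord j.+1)) :
  (j < n)%N -> ell (Defs.pcomp p (adjt n j)) q x = (ell p q x + before q x y)%N.
Proof.
move=> jn; have px : pos p x = j by rewrite pos_inord // ltnW.
have py : pos p y = j.+1 by rewrite pos_inord.
rewrite !ell_card.
have -> : [set b | before (Defs.pcomp p (adjt n j)) b x || before q b x] =
          y |: [set b | before p b x || before q b x].
  apply/setP=> b; rewrite !inE before_adjt // px eqxx andbT.
  rewrite [j == j.+1]ltn_eqF // andbF -py.
  by have [->|/eqP yb] := eqVneq b y; rewrite ?eqxx // ifF //;
    apply/negP => /eqP/pos_inj.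
rewrite cardsU1 addnC !inE /before px py ltnNge leqnSn /= -leqNgt; congr (_ + _)%N.
rewrite leq_eqVlt; suff /negPf -> : pos q x != pos q y by [].
by apply/eqP => /pos_inj exy; have := px; rewrite exy py => /eqP; lia.
Qed.

(** The previous lemma for the swapped ranking, in which [y] stands on the left; swapping again
    restores [p]. *)
Lemma ell_adjt_right p q j (x := p (inord j)) (y := p (inord j.+1)) :
  (j < n)%N -> ell p q y = (ell (Defs.pcomp p (adjt n j)) q y + before q y x)%N.
Proof.
move=> jn; have /= := ell_adjt_left (Defs.pcomp p (adjt n j)) q jn.
rewrite !pcompE /adjt tpermL tpermR => <-.
by rewrite /Defs.pcomp mulgA tperm2 mul1g.
Qed.

Lemma before_total p a b : a != b -> before p a b = ~~ before p b a.
Proof.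
move=> ab; rewrite /before -leqNgt [RHS]leq_eqVlt.
by case: eqP => // /pos_inj/eqP; rewrite (negPf ab).
Qed.

(* [y] is the first element of [q] that is misplaced in [p]. *)
Lemma insertion_step p q : p != q -> exists j (y := p (inord j.+1)),
  [/\ (j < n)%N, before q y (p (inord j)) & ell p q y = j.+1].
Proof.
move=> pq.
have [k pk] : exists k, p k != q k.
  apply/existsP; apply: contraR pq; rewrite negb_exists => /forallP pq.
  by apply/eqP/permP => k; apply/eqP; rewrite -[_ == _]negbK.
(* Take the first position [k] at which the rankings differ; the misplaced element is [q k]. *)
case: (@arg_minnP _ k (fun k => p k != q k) val pk) => {pk}k pk min_k.
have pq_lt (i : 'I_n.+1) : (i < k)%N -> p i = q i.
  by move=> ik; apply/eqP; apply: contraLR ik => /min_k; rewrite -leqNgt.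
have qk : pos q (q k) = k by rewrite /pos permK.
have before_qk b : before q b (q k) -> pos p b = pos q b.
  rewrite /before qk => bk; have := pq_lt _ bk; rewrite permKV.
  by move=> e; rewrite -[in LHS]e /pos permK.
(* Position [k] of [p] holds another element, and the earlier ones hold the same elements as in
   [q]. *)
have k_lt : (k < pos p (q k))%N.
  rewrite ltnNge; apply/negP; rewrite leq_eqVlt => /orP[/eqP e|lt].
    by move: pk; rewrite -[X in p X]inord_val -e perm_inord_pos eqxx.
  have := pq_lt _ lt; rewrite permKV => /perm_inj e.
  by move: lt; rewrite /pos -e ltnn.
have p_lt : (pos p (q k) < n.+1)%N by exact: ltn_ord.
exists (pos p (q k)).-1; rewrite /= (ltn_predK k_lt) perm_inord_pos; split.
- lia.
(* If [x] preceded [q k] in [q], it would have the same position in [p], below [k]; but it stands at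
   [k] or later. *)
- set x := p _; have px : pos p x = (pos p (q k)).-1 by rewrite pos_inord //; lia.
  have xk : q k != x by apply/eqP => e; move: px; rewrite -e; lia.
  rewrite before_total //; apply/negP => xq; have := before_qk _ xq.
  by move: xq; rewrite /before px qk; lia.
(* All predecessors of [q k] in [q] also precede it in [p], so the union is just its set of
   predecessors in [p]. *)
- rewrite ell_card -card_before; apply: eq_card => b; rewrite !inE.
  case: (boolP (before q b (q k))) => [bq|]; last by rewrite orbF.
  have := before_qk _ bq; move: bq; rewrite /before qk orbT => bk ->.
  by symmetry; lia.
Qed.

End AdjacentSwap.

(** * The right-hand side as a cost, and its two comparisons with word weights *)

Section Cost.
Context {R : realType} {n : nat}.
Variable phi : 'S_n.+1 -> R.
Hypotheses (phi_ge0 : nonneg_weight phi) (phi_decr : decreasing_weight phi).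
Implicit Types (p q : 'S_n.+1) (j k : nat).

Definition cumul k : R := \sum_(0 <= j < k) phi (adjt n j).

Definition cost p q : R :=
  \sum_(i < n.+1) cumul (ell p q i) - \sum_(i < n.+1) cumul i.

Lemma cumulS k : cumul k.+1 = cumul k + phi (adjt n k).
Proof. by rewrite /cumul big_nat_recr. Qed.

Lemma weight_adjt_ge0 j : (j < n)%N -> 0 <= phi (adjt n j).
Proof. by move=> jn; apply/phi_ge0/existsP; exists (Ordinal jn). Qed.

Lemma sum_cumul_pos p : \sum_(i < n.+1) cumul (pos p i) = \sum_(i < n.+1) cumul i.
Proof.
by rewrite (reindex_inj (@perm_inj _ p)); apply: eq_bigr => i _; rewrite /pos permK.
Qed.

Lemma sum_from_pos p q (i : 'I_n.+1) :
  \sum_(pos p i <= j < ell p q i) phi (adjt n j) =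
  cumul (ell p q i) - cumul (pos p i).
Proof.
rewrite /cumul (big_cat_nat (leq0n _) (pos_le_ell p q i)) /=.
by rewrite addrAC subrr add0r.
Qed.

Lemma costE p q : cost p q =
  \sum_(i < n.+1)
    2^-1 * (\sum_(pos p i <= j < ell p q i) phi (adjt n j) +
            \sum_(pos q i <= j < ell p q i) phi (adjt n j)).
Proof.
under eq_bigr => i _ do
  rewrite sum_from_pos [in X in _ + X]ellC sum_from_pos -(ellC p q).
rewrite -big_distrr /= big_split /= !sumrB !sum_cumul_pos /cost.
lra.
Qed.

Lemma costxx p : cost p p = 0.
Proof.
rewrite /cost -(sum_cumul_pos p); apply/eqP; rewrite subr_eq0; apply/eqP.
by apply: eq_bigr => i _; rewrite ellxx.
Qed.

(** The function [G] is arbitrary because two instances are needed: [cumul] for the cost, and [Posz]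
    for the termination of the sort. *)
Lemma sum_ell_adjt (V : zmodType) (G : nat -> V) p q j
    (x := p (inord j)) (y := p (inord j.+1)) : (j < n)%N ->
  \sum_(i < n.+1) G (ell p q i) =
  \sum_(i < n.+1) G (ell (Defs.pcomp p (adjt n j)) q i) +
  (if before q x y then G (ell p q x) - G (ell p q x).+1
   else G (ell p q y) - G (ell p q y).-1).
Proof.
move=> jn; have px : pos p x = j by rewrite pos_inord // ltnW.
have py : pos p y = j.+1 by rewrite pos_inord.
have yx : y != x by apply/eqP => e; move: py; rewrite e px; lia.
have splitE (H : 'I_n.+1 -> V) : \sum_i H i =
    H x + (H y + \sum_(i | (i != x) && (i != y)) H i).
  by rewrite (bigD1 x) //= (bigD1 y).
rewrite [LHS]splitE [X in _ = X + _]splitE.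
rewrite [X in _ = (_ + (_ + X)) + _](_ : _ =
  \sum_(i < n.+1 | (i != x) && (i != y)) G (ell p q i)); last first.
  apply: eq_bigr => i /andP[ix iy]; rewrite ell_adjt_other //.
    by apply: contra ix => /eqP; rewrite -px => /pos_inj ->.
  by apply: contra iy => /eqP; rewrite -py => /pos_inj ->.
set S := \sum_(_ < _ | _) _.
have := ell_adjt_left p q jn; have := ell_adjt_right p q jn.
rewrite -/x -/y (before_total _ yx); case: before => /=.
  rewrite addn0 addn1 => <- ->.
  by rewrite [RHS]addrC [RHS]addrA subrK.
rewrite addn0 addn1 => -> ->.
by rewrite /= -[RHS]addrA; congr (_ + _); rewrite [RHS]addrC [RHS]addrA subrK.
Qed.

Lemma cost_adjt_le p q j : (j < n)%N ->
  cost p q <= phi (adjt n j) + cost (Defs.pcomp p (adjt n j)) q.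
Proof.
move=> jn; rewrite /cost (sum_ell_adjt cumul p q jn).
set d := if _ then _ else _.
suff : d <= phi (adjt n j) by lra.
rewrite /d {d}.
have := weight_adjt_ge0 jn; case: ifP => [xy ge0|xy ge0].
  rewrite cumulS opprD addrA subrr add0r.
  apply: le_trans ge0; rewrite oppr_le0 weight_adjt_ge0 //.
  (* Applied after the swap, the bound gives [ell p q x < n] for the left neighbour [x], so the
     weight at that index is genuine, hence nonnegative. *)
  have := ell_le (Defs.pcomp p (adjt n j)) q (p (inord j)).
  by rewrite ell_adjt_left // xy addn1.
(* Here the drop is the weight at index [l], where [l.+1] is the [ell] of the right neighbour;
   [j <= l] and monotonicity bound it by the weight at [j]. *)
have := pos_le_ell p q (p (inord j.+1)); rewrite pos_inord //.
have := ell_le p q (p (inord j.+1)).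
case: ell => // l ln jl /=; rewrite cumulS addrAC subrr add0r.
move: jl; rewrite ltnS leq_eqVlt => /orP[/eqP -> //|jl].
by apply: phi_decr.
Qed.

Lemma cost_le_weight p w : all (@adjacent n) w ->
  cost p (foldl (@Defs.pcomp n) p w) <= weight phi w.
Proof.
elim: w p => [|t w IH] p /=; first by rewrite /weight big_nil costxx.
case/andP=> /existsP[j /eqP ->] aw; rewrite /weight big_cons.
by apply: le_trans (cost_adjt_le _ _ (ltn_ord j)) _; rewrite lerD2l IH.
Qed.

Lemma cost_attained p q : exists2 w, words p q w & weight phi w = cost p q.
Proof.
(* The induction is on the sum of all [ell p q i], which every insertion step lowers by one. *)
have [m] := ubnP (\sum_(i < n.+1) ell p q i)%N.
elim: m p => // m IH p.
have [<- _|/insertion_step[j /= [jn yx ellE]]] := eqVneq p q.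
  by exists [::]; rewrite // /weight big_nil costxx.
have xy : before q (p (inord j)) (p (inord j.+1)) = false.
  by apply/negbTE; move: yx; rewrite /before -leqNgt => /ltnW.
have sum_ell (V : zmodType) (G : nat -> V) : \sum_(i < n.+1) G (ell p q i) =
    \sum_(i < n.+1) G (ell (Defs.pcomp p (adjt n j)) q i) + (G j.+1 - G j).
  by rewrite (sum_ell_adjt G p q jn) xy ellE.
(* Working in [int] avoids truncated subtraction; the difference is [j.+1 - j], that is 1. *)
have := sum_ell int Posz; rewrite -!(big_morph _ PoszD (erefl _)) => e lt_m.
have [|w [aw ew] wE] := IH (Defs.pcomp p (adjt n j)).
  move: e lt_m; set s := (\sum_(i < _) ell p q i)%N.
  by set s' := (\sum_(i < _) ell _ q i)%N; lia.
exists (adjt n j :: w).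
  by split=> //=; rewrite aw andbT; apply/existsP; exists (Ordinal jn).
rewrite /weight big_cons -/(weight phi w) wE /cost sum_ell cumulS.
lra.
Qed.

End Cost.

Theorem proposition12 (R : realType) (n : nat) (phi : 'S_n.+1 -> R)
    (phi_ge0 : nonneg_weight phi) (phi_decr : decreasing_weight phi)
    (p q : 'S_n.+1) :
  wkendall phi p q =
  \sum_(i < n.+1)
    2^-1 * (\sum_(pos p i <= j < ell p q i) phi (adjt n j) +
            \sum_(pos q i <= j < ell p q i) phi (adjt n j)).
Proof.
rewrite -costE; have [[w [aw ew] <-] min_w] := wkendallP phi_ge0 p q.
apply/le_anti/andP; split; last by rewrite ew cost_le_weight.
have [v pqv <-] := cost_attained phi p q.
rewrite min_w //; by exists v.
Qed.
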